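(* There exists a function $f:\mathbb{N}\times\mathbb{N}\to\mathbb{N}$ such that for every $d,k\in\mathbb{N}$ and every matrix $A$ over $\mathbb{Q}$ of entry complexity $k$ whose column matroid $M=M(A)$ satisfies $\mathrm{csd}(M)=d$ and $\mathrm{csd}(M\setminus e)<d$ for every element $e$ of $M$, we have $|M|\le f(d,k)$.
   Context: The entry complexity of a rational matrix is the maximum, over its entries $r=p/q$ with $p,q$ coprime, of the binary encoding length $\lceil\log_2(|p|+1)\rceil+\lceil\log_2(|q|+1)\rceil$. For a matrix $A$ with $m$ rows and a subspace $K\subseteq\mathbb{Q}^m$, $M(A,K)$ is the matroid on the columns where $\{u_1,\dots,u_\ell\}$ is dependent iff $\sum\alpha_iu_i\in K$ for some $\alpha_i$ not all $0$; $M(A)=M(A,\{0\})$. Connected: any two elements lie in a common circuit; components: maximal connected restrictions. $\mathrm{csd}(A,K)=0$ if $M(A,K)$ has rank $0$; otherwise if disconnected, $\mathrm{csd}(A,K)=\max_C\mathrm{csd}(A_C,K)$ over components $C$ ($A_C$ the submatrix of columns of $C$); otherwise $\mathrm{csd}(A,K)=1+\min_{v\in\mathbb{Q}^m}\mathrm{csd}(A,K+\mathrm{span}(v))$. $\mathrm{csd}(M(A))=\mathrm{csd}(A,\{0\})$; $M\setminus e$ is represented by $A$ with column $e$ removed. *)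

(* Defs.v *)
From mathcomp Require Import all_boot all_order all_algebra.
Set Implicit Arguments. Unset Strict Implicit. Unset Printing Implicit Defensive.
Import Order.TTheory GRing.Theory Num.Theory.
Local Open Scope ring_scope.

Definition bitlen (x : nat) : nat := up_log 2 x.+1.

Definition rat_size (r : rat) : nat :=
  (bitlen `|numq r|%N + bitlen `|denq r|%N)%N.

Definition entry_complexity (m n : nat) (A : 'M[rat]_(m, n)) : nat :=
  \max_(i < m) \max_(j < n) rat_size (A i j).

Section Matroid.
Variables (m n : nat) (A : 'M[rat]_(m, n)).

Definition colv (j : 'I_n) : 'rV[rat]_m := (col j A)^T.

(* Subspaces K of Q^m are represented by the row space of a matrix 'M_m.
   The matroid M(A,K) lives on the column indices 'I_n. *)
Definition dependent (K : 'M[rat]_m) (T : {set 'I_n}) : Prop :=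
  exists alpha : 'I_n -> rat,
    (exists2 i, i \in T & alpha i != 0) /\
    ((\sum_(i in T) alpha i *: colv i)%R <= K)%MS.

Definition independent (K : 'M[rat]_m) (T : {set 'I_n}) : Prop :=
  ~ dependent K T.

Definition circuit (K : 'M[rat]_m) (C : {set 'I_n}) : Prop :=
  dependent K C /\ forall T : {set 'I_n}, T \proper C -> independent K T.

Definition rank_zero (K : 'M[rat]_m) (S : {set 'I_n}) : Prop :=
  forall T : {set 'I_n}, T \subset S -> independent K T -> T = set0.

(* M(A,K)|S is connected: any two distinct elements lie in a common circuit
   (circuits of a restriction are the circuits contained in S). *)
Definition connected (K : 'M[rat]_m) (S : {set 'I_n}) : Prop :=
  forall x y, x \in S -> y \in S -> x != y ->
    exists C, [/\ circuit K C, C \subset S, x \in C & y \in C].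

Definition component (K : 'M[rat]_m) (S C : {set 'I_n}) : Prop :=
  [/\ C \subset S, C != set0, connected K C &
      forall D : {set 'I_n}, C \subset D -> D \subset S -> connected K D -> D = C].

Inductive csd_le : {set 'I_n} -> 'M[rat]_m -> nat -> Prop :=
| csd_le_rank0 S K d : rank_zero K S -> csd_le S K d
| csd_le_disconn S K d :
    ~ rank_zero K S -> ~ connected K S ->
    (forall C, component K S C -> csd_le C K d) -> csd_le S K d
| csd_le_conn S K d (v : 'rV[rat]_m) :
    ~ rank_zero K S -> connected K S ->
    csd_le S (K + v)%MS d -> csd_le S K d.+1.

Definition csd_eq (S : {set 'I_n}) (K : 'M[rat]_m) (d : nat) : Prop :=
  csd_le S K d /\ forall d', csd_le S K d' -> (d <= d')%N.

End Matroid.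

Definition csd_mat (m n : nat) (A : 'M[rat]_(m, n)) (d : nat) : Prop :=
  csd_eq A [set: 'I_n] 0 d.

Definition csd_del (m n : nat) (A : 'M[rat]_(m, n)) (e : 'I_n) (d : nat) : Prop :=
  csd_eq A ([set: 'I_n] :\ e) 0 d.

(* Main.v *)
Require Import Defs.
From mathcomp Require Import all_boot all_order all_algebra.
From Stdlib Require Import Classical ClassicalEpsilon.
From mathcomp Require Import zify.

(* Suppose critical matrices with fixed d and k had unboundedly many columns. A
   matrix with csd at most d has circuits of size at most 2 ^ d, and when the
   matroid is connected the vector contracted in the definition of csd may be
   replaced by at most 2 ^ d columns: the support of a circuit of M(A, K + v)
   that is not dependent in M(A, K). Hence A has a decomposition of depth less
   than 2 ^ d that alternates splitting into direct summands and contracting a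
   column. By Cramer's rule, the coordinates of a column in terms of the columns
   contracted above it take finitely many values for given k. Higman's lemma,
   applied at each level of the decomposition, makes such decompositions
   well-quasi-ordered, so among infinitely many critical matrices of increasing
   size one is isomorphic to a proper restriction of another. Since csd is
   monotone under restriction, this contradicts criticality. *)

Set Implicit Arguments. Unset Strict Implicit. Unset Printing Implicit Defensive.
Import Order.TTheory GRing.Theory Num.Theory.
Local Open Scope ring_scope.

(** * Elementary vectors of a subspace *)

Section ElementaryVectors.
Variables (F : fieldType) (n : nat).
Implicit Types a b c : 'rV[F]_n.

Definition supp a : {set 'I_n} := [set i | a 0 i != 0].

Lemma in_supp a i : (i \in supp a) = (a 0 i != 0).
Proof. by rewrite inE. Qed.

Lemma supp_eq0 a : (supp a == set0) = (a == 0).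
Proof.
apply/eqP/eqP => [a0|->]; last by apply/setP => i; rewrite in_supp mxE eqxx inE.
by apply/rowP => i; rewrite mxE; apply/eqP/negPn; rewrite -in_supp a0 inE.
Qed.

Lemma supp_neq0 a i : i \in supp a -> a != 0.
Proof. by move=> ia; rewrite -supp_eq0; apply/set0Pn; exists i. Qed.

Lemma suppP a (S : {set 'I_n}) :
  reflect (forall i, i \notin S -> a 0 i = 0) (supp a \subset S).
Proof.
apply: (iffP subsetP) => [aS i iS|aS i].
  by apply/eqP/negPn; rewrite -in_supp; apply: contra iS; apply: aS.
by rewrite in_supp; apply: contraR => /aS ->.
Qed.

Definition pivot x a b : 'rV[F]_n := a - (a 0 x / b 0 x) *: b.

Lemma pivot0 x a b : x \in supp b -> x \notin supp (pivot x a b).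
Proof. by rewrite !in_supp negbK !mxE => bx; rewrite divfK // subrr. Qed.

Lemma pivotN x y a b : y \notin supp b -> pivot x a b 0 y = a 0 y.
Proof. by rewrite in_supp negbK !mxE => /eqP->; rewrite mulr0 subr0. Qed.

Lemma supp_pivot x a b : supp (pivot x a b) \subset supp a :|: supp b.
Proof.
apply/suppP => y; rewrite inE negb_or => /andP[ya yb].
by rewrite pivotN //; apply/eqP; rewrite -[_ == _]negbK -in_supp.
Qed.

Lemma pivot_sub p (R : 'M_(p, n)) x a b :
  (a <= R)%MS -> (b <= R)%MS -> (pivot x a b <= R)%MS.
Proof. by move=> aR bR; rewrite addmx_sub // eqmx_opp scalemx_sub. Qed.

Variables (p : nat) (R : 'M[F]_(p, n)).

(** When [R] is the space of linear relations among columns, the supports of these vectors are the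
    circuits. *)
Definition elementary a :=
  [/\ (a <= R)%MS, a != 0 & forall b, (b <= R)%MS -> b != 0 ->
       supp b \subset supp a -> supp b = supp a].

(** Induction on the support: if some nonzero [b] has smaller support, either it contains [x] and
    [b] replaces [a], or pivoting on [b] shrinks [a] and keeps its value at [x]. *)
Lemma elementary_through a x : (a <= R)%MS -> x \in supp a ->
  exists b, [/\ elementary b, x \in supp b & supp b \subset supp a].
Proof.
have [N] := ubnP #|supp a|; elim: N a => // N IHN a; rewrite ltnS => aN aR xa.
case: (classic (exists b, [/\ (b <= R)%MS, b != 0 & supp b \proper supp a])).
  case=> b [bR b0 ba]; have [xb|xb] := boolP (x \in supp b).
    have [|c [ec xc cb]] := IHN b _ bR xb.
      by apply: leq_trans aN; apply: proper_card.
    by exists c; split=> //; apply: subset_trans cb (proper_sub ba).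
  move: b0; rewrite -supp_eq0 => /set0Pn[y yb].
  have pa : supp (pivot y a b) \subset supp a.
    apply: subset_trans (supp_pivot _ _ _) _.
    by rewrite subUset subxx proper_sub.
  have [|||c [ec xc ca]] := IHN (pivot y a b).
  - apply: leq_trans aN; apply/proper_card/properP; split=> //.
    by exists y; [apply: (subsetP (proper_sub ba)) | apply: pivot0].
  - exact: pivot_sub.
  - by rewrite in_supp pivotN // -in_supp.
  by exists c; split=> //; apply: subset_trans pa.
move=> min; exists a; split=> //; split=> //; first exact: supp_neq0 xa.
move=> b bR b0 ba; apply/eqP; rewrite eqEproper ba /=.
by apply/negP => pba; apply: min; exists b.
Qed.

(** Elementary vectors inside the support of [a] span [a]. Testing this against a linear map [f]
    avoids writing the combination; an [f] ending in a [cokermx] yields membership in a subspace. *)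
Lemma elementary_span q (f : 'M[F]_(n, q)) a : (a <= R)%MS ->
  (forall b, elementary b -> supp b \subset supp a -> b *m f = 0) -> a *m f = 0.
Proof.
have [N] := ubnP #|supp a|; elim: N a => // N IHN a; rewrite ltnS => aN aR ef.
have [->|] := eqVneq a 0; first by rewrite mul0mx.
rewrite -supp_eq0 => /set0Pn[x xa].
have [b [eb xb ba]] := elementary_through aR xa.
have pa : supp (pivot x a b) \subset supp a.
  by apply: subset_trans (supp_pivot _ _ _) _; rewrite subUset subxx.
have : pivot x a b *m f = 0.
  apply: IHN => [||c ec ca].
  - apply: leq_trans aN; apply/proper_card/properP; split=> //.
    by exists x => //; apply: pivot0.
  - by case: eb => bR _ _; apply: pivot_sub.
  - by apply: ef => //; apply: subset_trans pa.
by rewrite mulmxBl -scalemxAl (ef b) // scaler0 subr0.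
Qed.

(** Eliminating a common element [w] gives elementary vectors [c] through [x] and [d] through [y],
    both avoiding [w]; one of the pairs [c, b] and [c, d] has a smaller union of supports. *)
Lemma elementary_trans a b x y : elementary a -> elementary b ->
  x \in supp a -> y \in supp b -> ~~ [disjoint supp a & supp b] ->
  exists c, [/\ elementary c, x \in supp c, y \in supp c
             & supp c \subset supp a :|: supp b].
Proof.
have [N] := ubnP #|supp a :|: supp b|.
elim: N a b => // N IHN a b; rewrite ltnS => abN ea eb xa yb ab.
have [ya|ya] := boolP (y \in supp a); first by exists a; rewrite subsetUl.
have [xb|xb] := boolP (x \in supp b); first by exists b; rewrite subsetUr.
move: ab; rewrite -setI_eq0 => /set0Pn[w]; rewrite inE => /andP[wa wb].
have [[aR a0 amin] [bR b0 bmin]] := (ea, eb).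
pose g := pivot w a b; have gR : (g <= R)%MS by apply: pivot_sub.
have wg : w \notin supp g by apply: pivot0.
have gab : supp g \subset supp a :|: supp b by apply: supp_pivot.
have [c [ec xc cg]] : exists c, [/\ elementary c, x \in supp c & supp c \subset supp g].
  by apply: elementary_through => //; rewrite in_supp pivotN // -in_supp.
have [d [ed yd dg]] : exists c, [/\ elementary c, y \in supp c & supp c \subset supp g].
  apply: elementary_through => //; move: ya wa wb yb; rewrite !in_supp !mxE negbK.
  by move=> /eqP-> wa wb yb; rewrite sub0r oppr_eq0 !mulf_neq0 ?invr_neq0.
have cab : supp c \subset supp a :|: supp b by apply: subset_trans gab.
have dab : supp d \subset supp a :|: supp b by apply: subset_trans gab.
(* Minimality of [s] would make the two supports equal, although only that of [s] contains [w].
   Hence [c] must meet [b] and, when the union does not shrink, [d] must meet [c]. *)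
have nosub e s : elementary e -> elementary s -> w \in supp s -> supp e \subset supp g ->
    ~ supp e \subset supp s.
  move=> [eR e0 _] [_ _ smin] ws eg es; move/negP: wg; apply.
  by apply: (subsetP eg); rewrite (smin e).
have cb : ~~ [disjoint supp c & supp b].
  apply/negP => cb; apply: (nosub c a) => //; apply/subsetP => i ic.
  by have := subsetP cab _ ic; rewrite inE (disjointFr cb ic) orbF.
have [lt_cb|le_cb] := ltnP #|supp c :|: supp b| #|supp a :|: supp b|.
  have [|e [ee xe ye es]] := IHN c b _ ec eb xc yb cb; first exact: leq_trans abN.
  by exists e; split=> //; apply: subset_trans es _; rewrite subUset cab subsetUr.
have cbE : supp c :|: supp b = supp a :|: supp b.
  by apply/eqP; rewrite eqEcard le_cb subUset cab subsetUr.
have cd : ~~ [disjoint supp c & supp d].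
  apply/negP => cd; apply: (nosub d b) => //; apply/subsetP => i id.
  by have := subsetP dab _ id; rewrite -cbE inE (disjointFl cd id).
have [|e [ee xe ye es]] := IHN c d _ ec ed xc yd cd.
  apply: leq_trans abN; apply/proper_card/properP.
  split; first by rewrite subUset cab.
  exists w; first by rewrite in_setU wa.
  by rewrite in_setU negb_or; apply/andP; split; apply: contra wg; apply/subsetP.
by exists e; split=> //; apply: subset_trans es _; rewrite subUset cab.
Qed.

End ElementaryVectors.

(** * Circuits and components of M(A, K) *)

Section ColumnRelations.
Variables (m n : nat) (A : 'M[rat]_(m, n)).
Implicit Types (a b : 'rV[rat]_n) (S T C D : {set 'I_n}).

(** The rows span the linear relations among the columns of [A] modulo [K]. *)
Definition rel q (K : 'M[rat]_(q, m)) : 'M_n := kermx (A^T *m cokermx K).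

Lemma relE q (K : 'M_(q, m)) a : (a <= rel K)%MS = (a *m A^T <= K)%MS.
Proof. by rewrite sub_kermx mulmxA -submxE. Qed.

Lemma sum_colv a S : supp a \subset S ->
  \sum_(i in S) a 0 i *: colv A i = a *m A^T.
Proof.
move/suppP => aS; rewrite mulmx_sum_row [RHS](bigID [in S]) /=.
rewrite [X in _ = _ + X]big1 ?addr0 => [|i /aS ->]; last by rewrite scale0r.
by apply: eq_bigr => i _; rewrite /colv tr_col.
Qed.

Lemma delta_colv j : delta_mx 0 j *m A^T = colv A j.
Proof. by rewrite -rowE /colv tr_col. Qed.

Lemma supp_delta j : supp (delta_mx 0 j : 'rV[rat]_n) = [set j].
Proof.
by apply/setP => i; rewrite in_supp mxE in_set1 eqxx /=; case: (i == j).
Qed.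

Lemma dependentP K T : dependent A K T <->
  exists a, [/\ (a *m A^T <= K)%MS, a != 0 & supp a \subset T].
Proof.
split=> [[al [[i iT ai] sK]]|[a [aK a0 aT]]].
  pose a : 'rV_n := \row_i (if i \in T then al i else 0).
  have aT : supp a \subset T by apply/suppP => j /negPf jT; rewrite mxE jT.
  exists a; split=> //; last by apply: (@supp_neq0 _ _ _ i); rewrite in_supp mxE iT.
  rewrite -(sum_colv aT); congr (_ <= _)%MS: sK.
  by apply: eq_bigr => j jT; rewrite mxE jT.
exists (a 0); split; last by rewrite (sum_colv aT).
move: a0; rewrite -supp_eq0 => /set0Pn[i ia].
by exists i; [apply: (subsetP aT) | rewrite -in_supp].
Qed.

Lemma circuitP K C : circuit A K C <-> exists2 a, elementary (rel K) a & supp a = C.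
Proof.
split=> [[/dependentP[a [aK a0 aC]] min]|[a [aR a0 amin] <-]].
  have minE b : (b <= rel K)%MS -> b != 0 -> supp b \subset C -> supp b = C.
    rewrite relE => bK b0 bC; apply/eqP; rewrite eqEproper bC /=; apply/negP.
    by move/min; apply; apply/dependentP; exists b.
  have aE : supp a = C by apply: minE; rewrite ?relE.
  by exists a => //; split; rewrite ?aE ?relE.
split; first by apply/dependentP; exists a; rewrite -relE.
move=> T Ta /dependentP[b [bK b0 bT]]; have ba := subset_trans bT (proper_sub Ta).
have /properP[_ [i ia iT]] := Ta.
by move: ia iT; rewrite -(amin b) ?relE // => ib; rewrite (subsetP bT).
Qed.

Lemma rank_zeroP K S : rank_zero A K S <-> forall j, j \in S -> (colv A j <= K)%MS.
Proof.
split=> [rS j jS|SK T TS indT].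
  have : dependent A K [set j].
    apply: NNPP => /(rS [set j]); rewrite sub1set => /(_ jS)/setP/(_ j).
    by rewrite !inE eqxx.
  case/dependentP => a [aK a0 aj]; move: aK; rewrite -(sum_colv aj) big_set1.
  rewrite -supp_eq0 in a0; have /set0Pn[i ia] := a0.
  have := subsetP aj _ ia; rewrite inE => /eqP ij; move: ia; rewrite ij in_supp => aj0.
  by rewrite (eqmx_scale _ aj0).
apply/eqP/negPn/negP => /set0Pn[j jT]; apply: indT; apply/dependentP.
exists (delta_mx 0 j); rewrite delta_colv supp_delta sub1set; split=> //.
  by apply: SK; apply: (subsetP TS).
by apply: (@supp_neq0 _ _ _ j); rewrite supp_delta set11.
Qed.

Lemma connected1 K x : connected A K [set x].
Proof. by move=> y z; rewrite !inE => /eqP-> /eqP->; rewrite eqxx. Qed.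

Lemma connected_supp K a : elementary (rel K) a -> connected A K (supp a).
Proof. by move=> ea x y xa ya _; exists (supp a); split=> //; apply/circuitP; exists a. Qed.

Lemma connectedU K C D : connected A K C -> connected A K D ->
  ~~ [disjoint C & D] -> connected A K (C :|: D).
Proof.
move=> cC cD /[!(=^~ setI_eq0)] /set0Pn[z /[!inE] /andP[zC zD]].
have mono (X : {set _}) x y : X \subset C :|: D -> (exists Z, [/\ circuit A K Z, Z \subset X, x \in Z & y \in Z]) ->
    exists Z, [/\ circuit A K Z, Z \subset C :|: D, x \in Z & y \in Z].
  by move=> XCD [Z [cZ ZX xZ yZ]]; exists Z; split=> //; exact: subset_trans ZX XCD.
have CD x y : x \in C -> y \in D -> x != y ->
    exists Z, [/\ circuit A K Z, Z \subset C :|: D, x \in Z & y \in Z].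
  move=> xC yD xy.
  have [xz|xz] := eqVneq x z.
    by apply: (mono D); [apply: subsetUr | apply: cD; rewrite // xz].
  have [yz|yz] := eqVneq z y.
    by apply: (mono C); [apply: subsetUl | apply: cC; rewrite // -yz].
  have [_ [/circuitP[a ea <-] aC xa za]] := cC _ _ xC zC xz.
  have [_ [/circuitP[b eb <-] bD zb yb]] := cD _ _ zD yD yz.
  have [|c [ec xc yc cab]] := elementary_trans ea eb xa yb.
    by rewrite -setI_eq0; apply/set0Pn; exists z; rewrite inE za.
  exists (supp c); split=> //; first by apply/circuitP; exists c.
  by apply: subset_trans cab _; apply: setUSS.
move=> x y /[!inE] /orP[xC|xD] /orP[yC|yD] xy.
- by apply: (mono C); [apply: subsetUl | apply: cC].
- exact: CD.
- by have [|Z [cZ ZCD yZ xZ]] := CD y x yC xD; rewrite 1?eq_sym //; exists Z.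
- by apply: (mono D); [apply: subsetUr | apply: cD].
Qed.

Lemma component_above K S D : D != set0 -> D \subset S -> connected A K D ->
  exists2 C, component A K S C & D \subset C.
Proof.
have [N] := ubnP (#|S| - #|D|); elim: N D => // N IHN D /[!ltnS] SDN D0 DS cD.
case: (classic (exists E : {set _}, [/\ D \proper E, E \subset S & connected A K E])).
  case=> E [DE ES cE]; have [||||C cC EC] := IHN E => //.
  - have := proper_card DE; have := subset_leq_card ES; lia.
  - by apply: contraNneq D0 => E0; move: DE; rewrite E0 properE subset0 sub0set andbF.
  by exists C => //; apply: subset_trans (proper_sub DE) EC.
move=> max; exists D => //; split=> // E DE ES cE; apply/esym/eqP.
by rewrite eqEproper DE; apply/negP => pDE; apply: max; exists E.
Qed.

Lemma component_absorbs K S C D : component A K S C -> D \subset S ->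
  connected A K D -> ~~ [disjoint C & D] -> D \subset C.
Proof.
case=> CS _ cC max DS cD CD; rewrite -(max (C :|: D)) ?subsetUr ?subsetUl //.
  by rewrite subUset CS.
exact: connectedU.
Qed.

(** For disjoint [C] and [D] this is the direct sum condition. [K] may have any number of rows, so
    that a list of contracted columns can take its place. *)
Definition separated q (K : 'M[rat]_(q, m)) C D := forall a b,
  supp a \subset C -> supp b \subset D ->
  ((a + b) *m A^T <= K)%MS -> (a *m A^T <= K)%MS.

(** A circuit inside [S] lies in [C] or misses it, so masking an elementary relation by [C] keeps it
    or kills it. Elementary vectors span all relations. *)
Lemma component_separated K S C : component A K S C -> separated K C (S :\: C).
Proof.
move=> compC a b aC bD abK; have [CS _ _ _] := compC.
pose mask : 'M[rat]_n := diag_mx (\row_i (i \in C)%:R).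
have maskE c i : (c *m mask) 0 i = if i \in C then c 0 i else 0.
  by rewrite mul_mx_diag !mxE; case: ifP; rewrite ?mulr1 ?mulr0.
have abS : supp (a + b) \subset S.
  apply/suppP => i iS; rewrite mxE (suppP _ _ aC) ?(suppP _ _ bD) ?addr0 ?inE //.
    by rewrite (negPf iS) andbF.
  by apply: contra iS; apply/subsetP.
suff -> : a = (a + b) *m mask.
  rewrite -relE submxE -mulmxA; apply/eqP; apply: (elementary_span (R := rel K)).
    by rewrite relE.
  move=> c ec cab; apply/eqP; rewrite mulmxA -submxE.
  have cS := subset_trans cab abS; have [cR _ _] := ec.
  have [dis|/(component_absorbs compC cS (connected_supp ec)) cC] :=
    boolP [disjoint C & supp c].
    suff -> : c *m mask = 0 by apply: sub0mx.
    apply/rowP => i; rewrite maskE mxE; case: ifP => // iC.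
    by apply/eqP; rewrite -[_ == _]negbK -in_supp (disjointFr dis iC).
  suff -> : c *m mask = c by [].
  by apply/rowP => i; rewrite maskE; case: ifPn => // iC; rewrite (suppP _ _ cC).
apply/rowP => i; rewrite maskE mxE; case: ifPn => iC; last exact: (suppP _ _ aC).
by rewrite (suppP _ _ bD) ?addr0 // inE iC.
Qed.

(** When every element is a loop, all circuits are singletons and no two elements share one. *)
Lemma connected_rank_zero K S x : connected A K S -> rank_zero A K S -> x \in S ->
  S = [set x].
Proof.
move=> cS /rank_zeroP rS xS; apply/eqP; rewrite eq_sym eqEsubset sub1set xS /=.
apply/subsetP => y yS; rewrite inE; apply/negPn/negP => yx.
have [_ [/circuitP[a [_ _ amin] <-] aS ya xa]] := cS y x yS xS yx.
suff /setP/(_ y) : supp (delta_mx 0 x : 'rV[rat]_n) = supp a.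
  by rewrite ya supp_delta inE (negPf yx).
apply: amin; rewrite ?supp_delta ?sub1set // ?relE ?delta_colv; first exact: rS.
by apply: (@supp_neq0 _ _ _ x); rewrite supp_delta set11.
Qed.

Lemma csd_leS S K d : csd_le A S K d -> csd_le A S K d.+1.
Proof.
elim=> {S K d} [S K d r0|S K d nr nc _ IH|S K d v nr cS _ IH].
- exact: csd_le_rank0.
- exact: csd_le_disconn.
- exact: csd_le_conn IH.
Qed.

(** Spares later inductions the case split of [csd_le]: the components of [S], or [S] itself, are
    among the connected subsets. *)
Lemma csd_le_connected_subsets S K d :
  (forall C, C \subset S -> connected A K C -> ~ rank_zero A K C -> csd_le A C K d) ->
  csd_le A S K d.
Proof.
move=> CSd; have [r0|nr] := classic (rank_zero A K S); first exact: csd_le_rank0.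
have [cS|nc] := classic (connected A K S); first exact: CSd.
apply: csd_le_disconn => // C [CS _ cC _].
by have [r0|nrC] := classic (rank_zero A K C); [apply: csd_le_rank0 | apply: CSd].
Qed.

End ColumnRelations.

(** * Invariance and monotonicity of csd *)

Section Pushforward.
Variables (F : fieldType) (n1 n2 : nat) (phi : 'I_n1 -> 'I_n2).
Implicit Types (a : 'rV[F]_n1) (b : 'rV[F]_n2).

Definition push a : 'rV[F]_n2 := \row_y \sum_(i | phi i == y) a 0 i.

Lemma push_mul q (B : 'M_(n2, q)) a : push a *m B = a *m rowsub phi B.
Proof.
apply/rowP => k; rewrite !mxE (partition_big phi predT) //=.
apply: eq_bigr => y _; rewrite mxE mulr_suml; apply: eq_bigr => i /eqP <-.
by rewrite mxE.
Qed.

Lemma supp_push a : supp (push a) \subset phi @: supp a.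
Proof.
apply/suppP => y ya; rewrite mxE big1 // => i /eqP iy.
apply/eqP; rewrite -[_ == _]negbK -in_supp; apply: contra ya => ia.
by rewrite -iy imset_f.
Qed.

Hypothesis phi_inj : injective phi.

Lemma pushE a i : push a 0 (phi i) = a 0 i.
Proof.
by rewrite mxE (eq_bigl (pred1 i)) ?big_pred1_eq // => j; rewrite /= (inj_eq phi_inj).
Qed.

Lemma supp_push_inj a : supp (push a) = phi @: supp a.
Proof.
apply/eqP; rewrite eqEsubset supp_push /=; apply/subsetP => _ /imsetP[i ia ->].
by rewrite in_supp pushE -in_supp.
Qed.

Lemma push_neq0 a : (push a != 0) = (a != 0).
Proof. by rewrite -!supp_eq0 supp_push_inj imset_eq0. Qed.

Lemma push_surj b (T : {set 'I_n1}) : supp b \subset phi @: T ->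
  exists2 a, supp a \subset T & push a = b.
Proof.
move=> bT; exists (\row_i b 0 (phi i)).
  apply/suppP => i iT; rewrite mxE (suppP _ _ bT) //.
  by rewrite (mem_imset _ _ phi_inj).
apply/rowP => y; have [/imsetP[i iT ->]|yT] := boolP (y \in phi @: T).
  by rewrite pushE mxE.
rewrite (suppP _ _ bT) // mxE big1 // => i /eqP iy; rewrite mxE.
by rewrite iy (suppP _ _ bT).
Qed.

End Pushforward.

Lemma addmx_subl (F : fieldType) m n p (x y : 'M[F]_(p, n)) (K : 'M_(m, n)) :
  (x <= K)%MS -> ((x + y)%R <= K)%MS = (y <= K)%MS.
Proof.
move=> xK; apply/idP/idP => [xyK|yK]; last by rewrite addmx_sub.
by rewrite -[y](addKr x) addmx_sub // eqmx_opp.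
Qed.

Lemma sub_add_row (F : fieldType) m n (x : 'rV[F]_n) (K : 'M_(m, n)) (v : 'rV_n) :
  (x <= K + v)%MS <-> exists t : F, (x - t *: v <= K)%MS.
Proof.
split=> [/sub_addsmxP[[u w] ->]|[t xt]].
  exists (w 0 0); rewrite /= [w]mx11_scalar mul_scalar_mx mxE eqxx mulr1n addrK.
  exact: submxMl.
rewrite -[x](subrK (t *: v)) addmx_sub_adds ?scalemx_sub //.
Qed.

(** * Transfer of relations along an injection of columns *)

Section Transfer.
Variables (m1 n1 m2 n2 : nat) (A1 : 'M[rat]_(m1, n1)) (A2 : 'M[rat]_(m2, n2)).
Variables (phi : 'I_n1 -> 'I_n2) (phi_inj : injective phi).

(** For injective [phi], the first matroid on [S1] is a restriction of the second. Only relations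
    are compared, so the ambient spaces may differ. *)
Definition pullback (S1 : {set 'I_n1}) (K1 : 'M_m1) (K2 : 'M_m2) := forall a,
  supp a \subset S1 -> (a *m A1^T <= K1)%MS = (a *m rowsub phi A2^T <= K2)%MS.

Lemma pullbackS (S1 T1 : {set 'I_n1}) K1 K2 : T1 \subset S1 -> pullback S1 K1 K2 -> pullback T1 K1 K2.
Proof. by move=> TS pb a aT; apply: pb; apply: subset_trans TS. Qed.

Variables (S1 : {set 'I_n1}) (K1 : 'M[rat]_m1) (K2 : 'M[rat]_m2).
Hypothesis pb : pullback S1 K1 K2.

Lemma dependent_pullback (T : {set 'I_n1}) : T \subset S1 ->
  dependent A1 K1 T <-> dependent A2 K2 (phi @: T).
Proof.
move=> TS; split=> /dependentP[a [aK a0 aT]]; apply/dependentP.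
  exists (push phi a); rewrite push_mul -pb ?push_neq0 //; last exact: subset_trans TS.
  by split=> //; rewrite supp_push_inj // imsetS.
have [b bT ab] := push_surj phi_inj aT; exists b; split=> //.
  by rewrite pb ?(subset_trans bT) // -push_mul ab.
by rewrite -(push_neq0 phi_inj) ab.
Qed.

Lemma circuit_pullback (C : {set 'I_n1}) : C \subset S1 ->
  circuit A1 K1 C -> circuit A2 K2 (phi @: C).
Proof.
move=> CS [depC min]; split; first by apply/(dependent_pullback CS).
move=> T TC.
have [B BC TE] : exists2 B : {set 'I_n1}, B \subset C & T = phi @: B.
  exists (phi @^-1: T).
    apply/subsetP => i; rewrite inE => /(subsetP (proper_sub TC)).
    by rewrite (mem_imset _ _ phi_inj).
  apply/setP => y; apply/idP/imsetP => [yT|[i /[!inE] iT -> //]].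
  by have /imsetP[i _ yi] := subsetP (proper_sub TC) _ yT; exists i; rewrite // inE -yi.
move=> depT; apply: (min B).
  rewrite properEneq BC andbT; apply: contraTneq TC => BE.
  by rewrite TE BE properxx.
by apply/dependent_pullback; rewrite -?TE // (subset_trans BC).
Qed.

Lemma connected_pullback (C : {set 'I_n1}) : C \subset S1 ->
  connected A1 K1 C -> connected A2 K2 (phi @: C).
Proof.
move=> CS cC _ _ /imsetP[x xC ->] /imsetP[y yC ->]; rewrite (inj_eq phi_inj) => xy.
have [Z [cZ ZC xZ yZ]] := cC x y xC yC xy.
exists (phi @: Z); split; rewrite ?imset_f ?imsetS //.
by apply: circuit_pullback => //; apply: subset_trans CS.
Qed.

End Transfer.

(** Monotonicity of csd under restriction, independent of the representation. The point of the
    induction is to find a counterpart in [A1] of the contracted vector [v]. *)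
Lemma csd_le_pullback m1 n1 m2 n2 (A1 : 'M[rat]_(m1, n1)) (A2 : 'M[rat]_(m2, n2))
    (phi : 'I_n1 -> 'I_n2) (S1 : {set 'I_n1}) K1 (S2 : {set 'I_n2}) K2 d :
  injective phi -> phi @: S1 \subset S2 -> pullback A1 A2 phi S1 K1 K2 ->
  csd_le A2 S2 K2 d -> csd_le A1 S1 K1 d.
Proof.
move=> phi_inj + + csd2; elim: csd2 S1 K1 => {S2 K2 d}
    [S2 K2 d /rank_zeroP r0|S2 K2 d _ _ _ IH|S2 K2 d v _ _ _ IH] S1 K1 S12 pb.
- apply: csd_le_rank0; apply/rank_zeroP => j jS.
  rewrite -delta_colv pb ?supp_delta ?sub1set // -rowE row_rowsub -tr_col.
  by apply: r0; apply: (subsetP S12); rewrite imset_f.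
- apply: csd_le_connected_subsets => C CS cC nrC.
  have C0 : C != set0.
    apply: contra_not_neq nrC => ->; apply/rank_zeroP => j; by rewrite inE.
  have [|||D compD CD] := component_above (K := K2) (S := S2) (D := phi @: C) (A := A2).
  - by rewrite imset_eq0.
  - by apply: subset_trans S12; apply: imsetS.
  - exact: (connected_pullback phi_inj pb).
  by apply: (IH D) => //; apply: pullbackS pb.
apply: csd_le_connected_subsets => C CS cC nrC.
have CS2 : phi @: C \subset S2 by apply: subset_trans S12; apply: imsetS.
(* If [v] is, modulo [K2], a combination of the images of columns in [C], the same combination is
   contracted in [A1]. *)
have [[b bC bv]|nb] := classic (exists2 b, supp b \subset C & (v - b *m rowsub phi A2^T <= K2)%MS).
  apply: (csd_le_conn (v := b *m A1^T)) => //; apply: IH => // a aC.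
  have comb t : supp (a - t *: b) \subset S1.
    apply/suppP => i iS; have iC : i \notin C by apply: contra iS; apply/subsetP.
    by rewrite !mxE (suppP _ _ aC) ?(suppP _ _ bC) // mulr0 subr0.
  have E t : (a *m rowsub phi A2^T - t *: v <= K2)%MS = (a *m A1^T - t *: (b *m A1^T) <= K1)%MS.
    rewrite scalemxAl -mulmxBl pb // mulmxBl -scalemxAl.
    have -> : a *m rowsub phi A2^T - t *: v =
        - t *: (v - b *m rowsub phi A2^T) + (a *m rowsub phi A2^T - t *: (b *m rowsub phi A2^T)).
      by rewrite scalerBr !scaleNr opprK addrACA subrr addr0 addrC.
    by rewrite addmx_subl // scalemx_sub.
  apply/idP/idP => /sub_add_row[t tK]; apply/sub_add_row; exists t.
    by rewrite E.
  by rewrite -E.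
(* Here [K1] stays unchanged: a new relation would use [v] with a nonzero coefficient [t] and so
   express [v] through [C]. *)
apply: csd_leS; apply: IH => // a aC; rewrite (pullbackS CS pb) //.
apply/idP/idP => [aK|/sub_add_row[t tK]]; first exact: submx_trans (addsmxSl _ _).
have [t0|t0] := eqVneq t 0; first by rewrite t0 scale0r subr0 in tK.
case: nb; exists (t^-1 *: a).
  by apply/suppP => i iC; rewrite mxE (suppP _ _ aC) // mulr0.
rewrite -scalemxAl -opprB -[v in _ - v](scalerK t0) -scalerBr -scalerN.
by rewrite scalemx_sub // eqmx_opp.
Qed.

Lemma csd_le_eq_rel m n (A : 'M[rat]_(m, n)) (S T : {set 'I_n}) K K' d : T \subset S ->
  (forall a, supp a \subset T -> (a *m A^T <= K)%MS = (a *m A^T <= K')%MS) ->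
  csd_le A S K d -> csd_le A T K' d.
Proof.
move=> TS eqK; apply: (csd_le_pullback (phi := id)) => //; first by rewrite imset_id.
by move=> a aT; rewrite mxsub_id eqK.
Qed.

(** * Contraction of columns *)

Section ContractionBounds.
Variables (m n : nat) (A : 'M[rat]_(m, n)).
Implicit Types (a b : 'rV[rat]_n) (S T C D E : {set 'I_n}) (K : 'M[rat]_m).

Lemma relS K K' a : (K <= K')%MS -> (a <= rel A K)%MS -> (a <= rel A K')%MS.
Proof. by rewrite !relE => KK' /submx_trans->. Qed.

Lemma rel_comb K (v : 'rV_m) a b : (a <= rel A (K + v)%MS)%MS -> (b <= rel A (K + v)%MS)%MS ->
  exists s t : rat, ((s != 0) || (t != 0)) /\ ((s *: a + t *: b)%R <= rel A K)%MS.
Proof.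
rewrite !relE => /sub_add_row[s sK] /sub_add_row[t tK].
have [s0|s0] := eqVneq s 0.
  exists 1, 0; rewrite oner_eq0 scale1r scale0r addr0 relE; split=> //.
  by rewrite s0 scale0r subr0 in sK.
exists t, (- s); rewrite oppr_eq0 s0 orbT relE; split=> //.
have -> : (t *: a + - s *: b) *m A^T =
    t *: (a *m A^T - s *: v) - s *: (b *m A^T - t *: v).
  rewrite mulmxDl -!scalemxAl !scalerBr !scalerA scaleNr (mulrC t s) opprB.
  by rewrite addrA subrK.
by rewrite addmx_sub ?eqmx_opp // scalemx_sub.
Qed.

(** In the connected case, a circuit modulo [K] either lies inside one circuit modulo [K + v] or
    contains two of them between which [v] cancels. The resulting relation modulo [K] fills the
    circuit by minimality, whence one factor 2 per contraction. *)
Lemma elementary_card S K d a : csd_le A S K d ->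
  elementary (rel A K) a -> supp a \subset S -> (#|supp a| <= 2 ^ d)%N.
Proof.
move=> csdS; elim: csdS a => {S K d} [S K d r0|S K d _ _ _ IH|S K d v _ _ _ IH] a ea aS.
- have /set0Pn[x xa] : supp a != set0 by rewrite supp_eq0; case: ea.
  rewrite (connected_rank_zero (connected_supp ea) _ xa) ?cards1 ?expn_gt0 //.
  by move/rank_zeroP: r0 => r0; apply/rank_zeroP => j ja; apply/r0/(subsetP aS).
- have [||C compC aC] := component_above (A := A) (K := K) _ aS.
  + by rewrite supp_eq0; case: ea.
  + exact: connected_supp.
  exact: IH compC _ ea aC.
have [aR a0 amin] := ea.
have aR' : (a <= rel A (K + v)%MS)%MS by apply: relS aR; apply: addsmxSl.
have bound b : elementary (rel A (K + v)%MS) b -> supp b \subset supp a ->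
    (#|supp b| <= 2 ^ d)%N.
  by move=> eb ba; apply: IH => //; apply: subset_trans aS.
have le2 : (2 ^ d <= 2 ^ d.+1)%N by rewrite leq_exp2l.
have inK b : elementary (rel A (K + v)%MS) b -> supp b \subset supp a ->
    (b <= rel A K)%MS -> (#|supp a| <= 2 ^ d.+1)%N.
  move=> eb ba bR; have [_ b0 _] := eb; rewrite -(amin b) //.
  exact: leq_trans (bound b eb ba) le2.
have /set0Pn[x xa] : supp a != set0 by rewrite supp_eq0.
have [b [eb xb ba]] := elementary_through aR' xa.
have [bE|/subsetPn[y ya yb]] := boolP (supp a \subset supp b).
  by apply: leq_trans le2; apply: leq_trans (subset_leq_card bE) (bound b eb ba).
have [c [ec yc ca]] := elementary_through aR' ya.
have [[bR b0 _] [cR c0 _]] := (eb, ec).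
have [s [t [st0 stK]]] := rel_comb bR cR.
have stbc : supp (s *: b + t *: c) \subset supp b :|: supp c.
  apply/suppP => i; rewrite !inE negb_or => /andP[/negPn/eqP bi /negPn/eqP ci].
  by rewrite !mxE bi ci !mulr0 addr0.
(* The coordinate [y], present in [c] but not in [b], makes [b] and [c] linearly independent. *)
have st_neq0 : s *: b + t *: c != 0.
  apply/eqP => st; move/rowP/(_ y): (st); move: yb yc; rewrite !in_supp !mxE negbK.
  move=> /eqP-> yc /eqP; rewrite mulr0 add0r mulf_eq0 (negPf yc) orbF => /eqP t0.
  move: st0 st; rewrite t0 eqxx orbF scale0r addr0 => s0 /eqP.
  by rewrite scaler_eq0 (negPf s0) (negPf b0).
have stE := amin _ stK st_neq0 _.
rewrite -stE; last by apply: subset_trans stbc _; rewrite subUset ba.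
apply: leq_trans (subset_leq_card stbc) _; apply: leq_trans (leq_card_setU _ _) _.
by rewrite expnS mul2n -addnn leq_add ?bound.
Qed.

Definition restr S a : 'rV[rat]_n := \row_i if i \in S then a 0 i else 0.

Lemma supp_restr S a : supp (restr S a) = supp a :&: S.
Proof. by apply/setP => i; rewrite !inE mxE; case: ifP; rewrite ?andbT ?andbF ?eqxx. Qed.

Lemma restr_id S a : supp a \subset S -> restr S a = a.
Proof. by move/suppP=> aS; apply/rowP => i; rewrite mxE; case: ifPn => // /aS. Qed.

Lemma restrB S a b : restr S (a - b) = restr S a - restr S b.
Proof. by apply/rowP => i; rewrite !mxE; case: ifP; rewrite ?subrr. Qed.

Lemma separated_restr q (K : 'M_(q, m)) S C a : separated A K C (S :\: C) ->
  supp a \subset S -> (a *m A^T <= K)%MS -> (restr C a *m A^T <= K)%MS.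
Proof.
move=> sepC aS aK; apply: (sepC (restr C a) (restr (S :\: C) a)).
- by rewrite supp_restr subsetIr.
- by rewrite supp_restr subsetIr.
suff <- : a = restr C a + restr (S :\: C) a by [].
apply/rowP => i; rewrite !mxE inE; case: (i \in C); rewrite ?addr0 //= add0r.
by case: ifPn => // iS; rewrite (suppP _ _ aS).
Qed.

(** Zero rows keep the size independent of [E]. Adding this to [K] contracts the elements of [E]. *)
Definition colspan E : 'M[rat]_(n, m) := \matrix_i if i \in E then colv A i else 0.

Lemma mul_colspan E a : a *m colspan E = restr E a *m A^T.
Proof.
rewrite !mulmx_sum_row; apply: eq_bigr => i _; rewrite rowK mxE /colv tr_col.
by case: ifP; rewrite ?scaler0 ?scale0r.
Qed.

Lemma sub_add_colspan (x : 'rV_m) K E : (x <= K + colspan E)%MS <->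
  exists2 b, supp b \subset E & (x - b *m A^T <= K)%MS.
Proof.
split=> [/sub_addsmxP[[u w] ->]|[b bE xb]].
  exists (restr E w); first by rewrite supp_restr subsetIr.
  by rewrite -mul_colspan addrK submxMl.
by rewrite -[x](subrK (b *m A^T)) addmx_sub_adds // -(restr_id bE) -mul_colspan submxMl.
Qed.

(* Contracting elements outside a component [D] does not affect [D]; this fails
   for a contraction by an arbitrary vector. *)
Lemma csd_le_contract S K d E T : csd_le A S K d -> E \subset S -> T \subset S ->
  csd_le A T (K + colspan E)%MS d.
Proof.
move=> csdS; elim: csdS E T => {S K d}
    [S K d /rank_zeroP r0|S K d _ _ _ IH|S K d v _ _ _ IH] E T ES TS.
- apply: csd_le_rank0; apply/rank_zeroP => j jT.
  by apply: submx_trans (addsmxSl _ _); apply/r0/(subsetP TS).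
- apply: csd_le_connected_subsets => C CT cC nrC.
  have CS := subset_trans CT TS.
  have /set0Pn[x xC] : C != set0.
    by apply: contra_not_neq nrC => ->; apply/rank_zeroP => j; rewrite inE.
  have [|||D compD xD] := component_above (A := A) (K := K) (S := S) (D := [set x]).
  + by apply/set0Pn; exists x; rewrite inE.
  + by rewrite sub1set (subsetP CS).
  + exact: connected1.
  rewrite sub1set in xD; have sepD := component_separated compD.
  have [DS _ _ _] := compD.
  (* [D] is separated modulo [K], so the part on [D] of a relation that uses [E] needs only
     [E :&: D]. *)
  have splitD a : supp a \subset S -> (a *m A^T <= K + colspan E)%MS ->
      (restr D a *m A^T <= K + colspan (E :&: D))%MS.
    move=> aS /sub_add_colspan[b bE abK]; apply/sub_add_colspan.
    exists (restr D b); first by rewrite supp_restr setSI.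
    rewrite -mulmxBl -restrB; apply: separated_restr sepD _ _; last by rewrite mulmxBl.
    apply/suppP => i iS; rewrite !mxE (suppP _ _ aS) // (suppP _ _ bE) ?subr0 //.
    by apply: contra iS; apply/subsetP.
  have mono : (K + colspan (E :&: D) <= K + colspan E)%MS.
    apply/row_subP => i; set y := row _ _.
    have /sub_add_colspan[b bE yb] : (y <= K + colspan (E :&: D))%MS by apply: row_sub.
    by apply/sub_add_colspan; exists b => //; apply: subset_trans bE (subsetIl _ _).
  have CD : C \subset D.
    apply/subsetP => y yC; have [->//|yx] := eqVneq y x.
    have [_ [/circuitP[a ea <-] aC ya xa]] := cC y x yC xC yx.
    have [aR _ amin] := ea; have aS := subset_trans aC CS.
    (* The part of this circuit on [D] is still a nonzero relation, so by minimality it is the whole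
       circuit. *)
    suff aE : supp (restr D a) = supp a.
      by move: ya; rewrite -aE supp_restr inE => /andP[].
    apply: amin.
    + by rewrite relE; apply: submx_trans mono; apply: splitD; rewrite -?relE.
    + by apply: (@supp_neq0 _ _ _ x); rewrite supp_restr inE xa.
    + by rewrite supp_restr subsetIl.
  have := IH D compD (E :&: D) C (subsetIr _ _) CD.
  apply: csd_le_eq_rel => // a aC; apply/idP/idP => aK; first exact: submx_trans mono.
  by rewrite -(restr_id (subset_trans aC CD)); apply: splitD => //; apply: subset_trans CS.
apply: csd_le_connected_subsets => C CT cC nrC; apply: (csd_le_conn (v := v)) => //.
by rewrite -addsmxA (addsmxC (colspan E)) addsmxA; apply: IH => //; apply: subset_trans TS.
Qed.

(** If contracting [v] creates no new relation on [S], then [K] already suffices. Otherwise some new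
    circuit carries a nonzero multiple of [v] modulo [K], and contracting its elements contracts [v]
    too. *)
Lemma csd_le_contract_columns S K (v : 'rV_m) d : csd_le A S (K + v)%MS d ->
  csd_le A S K d \/
  exists E, [/\ E \subset S, (#|E| <= 2 ^ d)%N & csd_le A S (K + colspan E)%MS d].
Proof.
move=> csdS; have [[a [ea aS aK]]|none] := classic (exists a,
    [/\ elementary (rel A (K + v)%MS) a, supp a \subset S & ~~ (a *m A^T <= K)%MS]).
  right; exists (supp a); split=> //; first exact: elementary_card csdS ea aS.
  have [aR _ _] := ea; move: aR; rewrite relE => /sub_add_row[t tK].
  have t0 : t != 0 by apply: contraNneq aK => t0; rewrite t0 scale0r subr0 in tK.
  have vE : (v <= K + colspan (supp a))%MS.
    apply/sub_add_colspan; exists (t^-1 *: a).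
      by apply/suppP => i ia; rewrite mxE (suppP _ _ (subxx (supp a))) // mulr0.
    rewrite -scalemxAl -opprB -[v in _ - v](scalerK t0) -scalerBr -scalerN.
    by rewrite scalemx_sub // eqmx_opp.
  apply: csd_le_eq_rel (csd_le_contract csdS aS (subxx S)) => // b _.
  by rewrite -addsmxA (addsmxC v) addsmxA; rewrite (addsmx_idPl vE).
left; apply: csd_le_eq_rel csdS => // a aS.
apply/idP/idP => [aR|aK]; last by apply: submx_trans aK (addsmxSl _ _).
rewrite submxE -mulmxA; apply/eqP; apply: (elementary_span (R := rel A (K + v)%MS)).
  by rewrite relE.
move=> b eb ba; apply/eqP; rewrite mulmxA -submxE; apply: contraPT (none) => bK; apply.
by exists b; split=> //; apply: subset_trans aS.
Qed.

End ContractionBounds.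

(** * Embeddings *)

(* The columns [oS] of [oA], over the [t] columns contracted so far, which are
   the rows of [oL]. *)
Record obj t := Obj {
  om : nat; on : nat;
  oA : 'M[rat]_(om, on);
  oS : {set 'I_on};
  oL : 'M[rat]_(t, om) }.

(* A bijection of [O1] onto a restriction of [O2] that matches the i-th contracted
   column of [O1] with the i-th one of [O2] and preserves all linear relations. *)
Definition emb t (O1 O2 : obj t) := exists phi : 'I_(on O1) -> 'I_(on O2),
  [/\ {in oS O1 &, injective phi}, phi @: oS O1 \subset oS O2
    & forall a l, supp a \subset oS O1 ->
      a *m (oA O1)^T + l *m oL O1 = 0 <-> a *m rowsub phi (oA O2)^T + l *m oL O2 = 0].

Lemma emb_trans t (O1 O2 O3 : obj t) : emb O1 O2 -> emb O2 O3 -> emb O1 O3.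
Proof.
move=> [f [fI f12 fE]] [g [gI g23 gE]]; exists (g \o f).
have fS i : i \in oS O1 -> f i \in oS O2 by move=> iS; apply: (subsetP f12); rewrite imset_f.
split.
- by move=> i j iS jS /= /gI; rewrite !fS // => /(_ isT isT) /fI->.
- apply/subsetP => _ /imsetP[i iS ->]; apply: (subsetP g23).
  exact: (imset_f g (fS i iS)).
move=> a l aS; have paS : supp (push f a) \subset oS O2.
  apply: subset_trans (supp_push _ _) _; apply: subset_trans f12.
  exact: imsetS.
by rewrite fE // rowsub_comp -!(push_mul f) gE.
Qed.

(** Higman's subword order: a subsequence of the second list dominates the first term by term. *)
Inductive lemb (X : Type) (R : X -> X -> Prop) : seq X -> seq X -> Prop :=
| lemb_nil s : lemb R [::] s
| lemb_skip x s1 s2 : lemb R s1 s2 -> lemb R s1 (x :: s2)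
| lemb_cons x y s1 s2 : R x y -> lemb R s1 s2 -> lemb R (x :: s1) (y :: s2).

(** * Direct sums over the contracted columns *)

Section Separation.
Variables (m n : nat) (A : 'M[rat]_(m, n)) (t : nat) (L : 'M[rat]_(t, m)).
Implicit Types (S C : {set 'I_n}) (l : seq (obj t)).

(** The list gives direct summands of the matroid on [S] modulo [L], each separated from what
    remains after the earlier ones. *)
Inductive rep : {set 'I_n} -> seq (obj t) -> Prop :=
| rep_nil : rep set0 [::]
| rep_cons S C l : C \subset S -> separated A L C (S :\: C) -> rep (S :\: C) l ->
    rep S (Obj A C L :: l).

Lemma rep1 S : rep S [:: Obj A S L].
Proof.
apply: rep_cons => //; last by rewrite setDv; apply: rep_nil.
move=> a b _; rewrite setDv subset0 supp_eq0 => /eqP->; by rewrite addr0.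
Qed.

Lemma rep_cat C l1 : rep C l1 -> forall S l2, C \subset S ->
  separated A L C (S :\: C) -> rep (S :\: C) l2 -> rep S (l1 ++ l2).
Proof.
elim=> {C l1} [|C B l1 BC sepB _ IH] S l2 CS sepC repl2; first by rewrite setD0 in repl2.
have SB : (S :\: B) :\: (C :\: B) = S :\: C.
  apply/setP => i; rewrite !inE; case iB : (i \in B); rewrite ?andbF //=.
  by rewrite (subsetP BC).
apply: rep_cons; first exact: subset_trans CS.
  move=> a b aB bS abL; pose b1 := restr C b.
  apply: (sepB a b1) => //.
    apply/subsetP => i; rewrite supp_restr in_setI => /andP[/(subsetP bS)].
    by rewrite !in_setD => /andP[-> _] ->.
  (* The part of [b] outside [C] is removed by the separation of [C]; the rest lives in [C], where
     [sepB] applies. *)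
  apply: (sepC _ (restr (~: C) b)).
  - apply/suppP => i iC; rewrite !mxE (negPf iC) addr0.
    by rewrite (suppP _ _ aB) //; apply: contra iC; apply/subsetP.
  - apply/subsetP => i; rewrite supp_restr in_setI => /andP[/(subsetP bS)].
    by rewrite !in_setD in_setC => /andP[_ ->] ->.
  suff -> : a + b1 + restr (~: C) b = a + b by [].
  by apply/rowP => i; rewrite !mxE inE; case: (i \in C); rewrite ?addr0.
apply: IH; rewrite ?SB ?setSD //.
by move=> a b aC; apply: sepC; apply: subset_trans aC (subsetDl _ _).
Qed.

(** Separation with explicit coefficients over [L]: the share [w] is the only link between the two
    parts, which lets [emb] be checked on each part. *)
Lemma separated_split S C a b u : separated A L C S ->
  supp a \subset C -> supp b \subset S ->
  ((a + b) *m A^T + u *m L = 0 <->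
   exists w, a *m A^T + w *m L = 0 /\ b *m A^T + (u - w) *m L = 0).
Proof.
move=> sep aC bS; split=> [abu|[w [aw bw]]]; last first.
  have -> : (a + b) *m A^T + u *m L = (a *m A^T + w *m L) + (b *m A^T + (u - w) *m L).
    by rewrite addrACA -!mulmxDl [w + _]addrC subrK.
  by rewrite aw bw addr0.
have /submxP[w aw] : (a *m A^T <= L)%MS.
  apply: (sep _ b) => //; apply/submxP; exists (- u); apply/eqP.
  by rewrite mulNmx -addr_eq0 abu.
exists (- w); rewrite mulNmx aw subrr; split=> //.
by rewrite opprK mulmxDl -aw addrA addrC addrA -mulmxDl.
Qed.

End Separation.

(** On both sides a relation splits with some share [w] of the coefficients [u]; [f] and [g]
    preserve the two halves for the same [w]. *)
Lemma emb_glue t m1 n1 (A1 : 'M_(m1, n1)) (L1 : 'M_(t, m1)) m2 n2 (A2 : 'M_(m2, n2))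
    (L2 : 'M_(t, m2)) (S1 C1 : {set 'I_n1}) (S2 C2 : {set 'I_n2}) :
  C1 \subset S1 -> separated A1 L1 C1 (S1 :\: C1) ->
  C2 \subset S2 -> separated A2 L2 C2 (S2 :\: C2) ->
  emb (Obj A1 C1 L1) (Obj A2 C2 L2) ->
  emb (Obj A1 (S1 :\: C1) L1) (Obj A2 (S2 :\: C2) L2) ->
  emb (Obj A1 S1 L1) (Obj A2 S2 L2).
Proof.
move=> CS1 sep1 CS2 sep2 [/= f [fI f12 fE]] [/= g [gI g12 gE]].
have fC i : i \in C1 -> f i \in C2 by move=> iC; apply: (subsetP f12); rewrite imset_f.
have gC i : i \in S1 :\: C1 -> g i \in S2 :\: C2.
  by move=> iC; apply: (subsetP g12); rewrite imset_f.
exists (fun i => if i \in C1 then f i else g i); split=> /=.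
- move=> i j iS jS; case: ifPn => iC; case: ifPn => jC.
  + exact: fI.
  + move=> fg; have : g j \in S2 :\: C2 by apply: gC; rewrite inE jC.
    by rewrite -fg inE fC.
  + move=> fg; have : g i \in S2 :\: C2 by apply: gC; rewrite inE iC.
    by rewrite fg inE fC.
  + by apply: gI; rewrite inE ?iC ?jC.
- apply/subsetP => _ /imsetP[i iS ->]; case: ifPn => iC; first exact/(subsetP CS2)/fC.
  by have := gC i; rewrite !inE iC iS => /(_ isT) /andP[].
move=> a u aS; set phi := fun i => _.
have aE : a = restr C1 a + restr (S1 :\: C1) a.
  apply/rowP => i; rewrite !mxE inE; case: (i \in C1); rewrite ?addr0 //= add0r.
  by case: ifPn => // iS; rewrite (suppP _ _ aS).
have a1C : supp (restr C1 a) \subset C1 by rewrite supp_restr subsetIr.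
have a2C : supp (restr (S1 :\: C1) a) \subset S1 :\: C1 by rewrite supp_restr subsetIr.
have pushE : a *m rowsub phi A2^T =
    (push f (restr C1 a) + push g (restr (S1 :\: C1) a)) *m A2^T.
  rewrite mulmxDl !push_mul !mulmx_sum_row -big_split /=; apply: eq_bigr => i _.
  rewrite !row_rowsub !mxE inE /phi; case: (i \in C1) => /=; first by rewrite scale0r addr0.
  by rewrite scale0r add0r; case: ifPn => // iS; rewrite (suppP _ _ aS).
rewrite pushE {1}aE (separated_split _ sep1) // (separated_split _ sep2).
- split=> -[w [w1 w2]]; exists w; move: w1 w2.
    by rewrite fE // gE // !push_mul.
  by rewrite !push_mul fE // gE.
- by apply: subset_trans (supp_push _ _) _; apply: subset_trans f12; apply: imsetS.
- by apply: subset_trans (supp_push _ _) _; apply: subset_trans g12; apply: imsetS.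
Qed.

Lemma rep_emb t m1 n1 (A1 : 'M_(m1, n1)) (L1 : 'M_(t, m1)) m2 n2 (A2 : 'M_(m2, n2))
    (L2 : 'M_(t, m2)) S1 S2 l1 l2 (y0 : 'I_n2) :
  row_free L1 -> row_free L2 -> lemb (@emb t) l1 l2 -> rep A1 L1 S1 l1 -> rep A2 L2 S2 l2 ->
  emb (Obj A1 S1 L1) (Obj A2 S2 L2).
Proof.
move=> fr1 fr2 l12; elim: l12 S1 S2 => {l1 l2} [l2|O l1 l2 _ IH|O1 O2 l1 l2 O12 _ IH] S1 S2 rep1 rep2.
(* [S1] is empty, so [y0] is an arbitrary value. Relations reduce to [u *m L1 = 0] and
   [u *m L2 = 0], both equivalent to [u = 0] by independence of the rows. *)
- inversion rep1; exists (fun=> y0); split=> /=.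
  + by move=> i j; rewrite inE.
  + by rewrite imset0 sub0set.
  + move=> a u; rewrite subset0 supp_eq0 => /eqP->; rewrite !mul0mx !add0r.
    by split=> /eqP; rewrite mulmx_free_eq0 // => /eqP->; rewrite mul0mx.
- inversion rep2 as [|S C l CS sep repl]; subst.
  have [f [fI f12 fE]] := IH _ _ rep1 repl; exists f; split=> //.
  by apply: subset_trans f12 _; apply: subsetDl.
inversion rep1 as [|S C l CS sep repl]; subst.
inversion rep2 as [|S' C' l' CS' sep' repl']; subst.
exact: emb_glue (IH _ _ repl repl').
Qed.

(** * Bounded-depth decompositions *)

Definition loop t (O : obj t) : Prop :=
  exists2 j, oS O = [set j] & (colv (oA O) j <= oL O)%MS.

(** A leaf is a loop. An inner node contracts a column [j] outside the span of [oL], which keeps the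
    rows independent, and splits the result. The element [j] remains in the set and becomes a
    loop. *)
Fixpoint block h t (O : obj t) : Prop := loop O \/
  match h with
  | 0 => False
  | h'.+1 => exists2 j, j \in oS O /\ ~~ (colv (oA O) j <= oL O)%MS &
      exists2 l, rep (oA O) (col_mx (oL O) (colv (oA O) j)) (oS O) l
               & List.Forall (@block h' _) l
  end.

Definition decomposed h m n (A : 'M[rat]_(m, n)) t (L : 'M[rat]_(t, m)) S : Prop :=
  exists2 l, rep A L S l & List.Forall (@block h t) l.

Lemma block_leq h h' t (O : obj t) : (h <= h')%N -> block h O -> block h' O.
Proof.
elim: h h' t O => [|h IH] [|h'] t O //= hh' [lO|] //; try by left.
case=> j jO [l repl lh]; right; exists j => //; exists l => //.
by apply: List.Forall_impl lh => O'; apply: IH.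
Qed.

Lemma decomposed_leq h h' m n (A : 'M[rat]_(m, n)) t (L : 'M_(t, m)) S :
  (h <= h')%N -> decomposed h A L S -> decomposed h' A L S.
Proof.
move=> hh' [l repl lh]; exists l => //.
by apply: List.Forall_impl lh => O; apply: block_leq.
Qed.

Lemma row_free_col_mx (F : fieldType) t m (L : 'M[F]_(t, m)) (u : 'rV_m) :
  row_free L -> ~~ (u <= L)%MS -> row_free (col_mx L u).
Proof.
move=> frL uL; apply: inj_row_free => v; rewrite -[v]hsubmxK mul_row_col.
set x := lsubmx v; set y := rsubmx v; rewrite [y]mx11_scalar mul_scalar_mx => xy0.
have [y0|y0] := eqVneq (y 0 0) 0.
  move: xy0; rewrite y0 scale0r addr0 -[X in _ = X](mul0mx _ L) => /(row_free_inj frL)->.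
  by rewrite raddf0 row_mx0.
case/negP: uL; rewrite -[u](scalerK y0) scalemx_sub //.
by move/eqP: xy0; rewrite addrC addr_eq0 => /eqP->; rewrite eqmx_opp submxMl.
Qed.

Section Decomposition.
Variables (m n : nat) (A : 'M[rat]_(m, n)).
Implicit Types (S C : {set 'I_n}) (K : 'M[rat]_m).

Lemma decomposed_block h t (L : 'M_(t, m)) S : block h (Obj A S L) -> decomposed h A L S.
Proof. by move=> bS; exists [:: Obj A S L]; [apply: rep1 | constructor]. Qed.

(** [K] is the span of [L] and the columns in [s]. These are contracted one by one, each adding at
    most one level; a column already spanned is skipped, which preserves [row_free]. *)
Lemma decomposed_contract S d h (s : seq 'I_n) t (L : 'M_(t, m)) K :
  {subset s <= S} -> row_free L -> csd_le A S K d ->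
  (L <= K)%MS -> {in s, forall j, colv A j <= K}%MS ->
  (forall q (M : 'M_(q, m)), (L <= M)%MS -> {in s, forall j, colv A j <= M}%MS -> (K <= M)%MS) ->
  (forall t' (L' : 'M_(t', m)), (K :=: L')%MS -> row_free L' -> decomposed h A L' S) ->
  decomposed (h + size s) A L S.
Proof.
move=> sS frL csdS LK sK least decS.
elim: s t L sS frL LK sK least => [|j s IH] t L sS frL LK sK least.
  rewrite addn0; apply: decS => //; apply/eqmxP; rewrite LK andbT.
  by apply: least => // j; rewrite inE.
have sS' : {subset s <= S} by move=> i is_; apply: sS; rewrite inE is_ orbT.
have sK' : {in s, forall i, colv A i <= K}%MS.
  by move=> i is_; apply: sK; rewrite inE is_ orbT.
have [jL|jL] := boolP (colv A j <= L)%MS.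
  apply: (@decomposed_leq (h + size s)); first by rewrite leq_add2l.
  apply: IH => // q M LM sM; apply: least => // i; rewrite inE => /orP[/eqP->|/sM //].
  exact: submx_trans LM.
apply: decomposed_block; rewrite addnS; right; exists j.
  by split=> //; apply: sS; rewrite inE eqxx.
apply: IH => //=.
- exact: row_free_col_mx.
- by rewrite -addsmxE addsmx_sub LK sK // inE eqxx.
- move=> q M; rewrite -addsmxE addsmx_sub => /andP[LM jM] sM; apply: least => // i.
  by rewrite inE => /orP[/eqP->|/sM].
Qed.

Lemma separated_eqmx q1 (K1 : 'M_(q1, m)) q2 (K2 : 'M_(q2, m)) C S :
  (K1 :=: K2)%MS -> separated A K1 C S -> separated A K2 C S.
Proof. by move=> eqK sep a b aC bS; rewrite -!eqK; apply: sep. Qed.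

Lemma decomposed_connected_subsets h t (L : 'M_(t, m)) S K : (K :=: L)%MS ->
  (forall C, C \subset S -> C != set0 -> connected A K C -> decomposed h A L C) ->
  decomposed h A L S.
Proof.
move=> KL; have [N] := ubnP #|S|; elim: N S => // N IHN S /[!ltnS] SN decC.
have [->|/set0Pn[x xS]] := eqVneq S set0.
  by exists [::]; constructor.
have [|||C compC xC] := component_above (A := A) (K := K) (S := S) (D := [set x]).
- by apply/set0Pn; exists x; rewrite inE.
- by rewrite sub1set.
- exact: connected1.
have [CS C0 cC _] := compC; rewrite sub1set in xC.
have [l repl lh] := decC C CS C0 cC.
have [||l' repl' lh'] := IHN (S :\: C).
- apply: leq_trans SN; apply/proper_card/properP; split; first exact: subsetDl.
  by exists x; rewrite // inE xC.
- by move=> D DS; apply: decC; apply: subset_trans DS (subsetDl _ _).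
exists (l ++ l'); last exact/List.Forall_app.
apply: rep_cat repl _ _ CS _ repl'.
exact: separated_eqmx KL (component_separated compC).
Qed.

(** A vector contraction that leaves csd at most [d] is replaced by at most [2 ^ d] columns. The
    height thus starts at 0 and grows by [2 ^ d] from [d] to [d.+1]. *)
Lemma csd_le_decomposed d t (L : 'M_(t, m)) S K : (K :=: L)%MS -> row_free L ->
  csd_le A S K d -> decomposed (2 ^ d).-1 A L S.
Proof.
elim: d t L S K => [|d IHd] t L S K KL frL csdS;
    apply: (decomposed_connected_subsets KL) => C CS /set0Pn[x xC] cC;
    have csdC := csd_le_eq_rel CS (fun _ _ => erefl) csdS;
    have [r0|nr] := classic (rank_zero A K C).
- apply: decomposed_block; left; exists x; first exact: connected_rank_zero r0 xC.
  by rewrite /= -KL; move/rank_zeroP: r0; apply.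
(* Bound 0 leaves no contraction, so a connected set must have rank zero. *)
- by inversion csdC.
- apply: (@decomposed_leq 0) => //.
  apply: decomposed_block; left; exists x; first exact: connected_rank_zero r0 xC.
  by rewrite /= -KL; move/rank_zeroP: r0; apply.
inversion csdC as [|? ? ? ? nc|? ? ? v ? ? csdv]; first by []; subst.
  by [].
have pow : (2 ^ d.+1).-1 = ((2 ^ d).-1 + 2 ^ d)%N.
  by have := expn_gt0 2 d; rewrite expnS; lia.
rewrite pow; case: (csd_le_contract_columns csdv) => [csdK|[E [EC Ed csdE]]].
  by apply: (@decomposed_leq (2 ^ d).-1); rewrite ?leq_addr //; apply: IHd csdK.
apply: (@decomposed_leq ((2 ^ d).-1 + size (enum E))).
  by rewrite leq_add2l -cardE.
apply: (decomposed_contract _ frL csdE).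
- by move=> i; rewrite mem_enum; apply/subsetP.
- by rewrite -KL addsmxSl.
- move=> i; rewrite mem_enum => iE; apply: submx_trans (addsmxSr _ _).
  by have := row_sub i (colspan A E); rewrite rowK iE.
- move=> q M LM EM; rewrite addsmx_sub KL LM; apply/row_subP => i; rewrite rowK.
  by case: ifP => iE; rewrite ?sub0mx // EM // mem_enum.
by move=> t' L' KL' frL'; apply: IHd KL' frL' csdE.
Qed.

End Decomposition.

(** * Well-quasi-orders and Higman's lemma *)

Lemma choice_fun (X Y : Type) (P : X -> Y -> Prop) :
  (forall x, exists y, P x y) -> exists f, forall x, P x (f x).
Proof.
move=> ex; exists (fun x => sval (constructive_indefinite_description _ (ex x))).
by move=> x; case: (constructive_indefinite_description _ (ex x)).
Qed.

Lemma homo_ltn_succ (u : nat -> nat) :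
  (forall i, u i < u i.+1)%N -> {homo u : i j / (i < j)%N}.
Proof.
move=> uS i j; elim: j => // j IH; rewrite ltnS leq_eqVlt => /orP[/eqP->//|/IH ui].
exact: ltn_trans ui (uS j).
Qed.

Lemma infinitely_often (P : nat -> Prop) :
  (forall N, exists2 i, (N <= i)%N & P i) ->
  exists2 u : nat -> nat, {homo u : i j / (i < j)%N} & forall i, P (u i).
Proof.
move=> inf; have /choice_fun[next nextP] : forall N, exists i, (N <= i)%N /\ P i.
  by move=> N; have [i] := inf N; exists i.
exists (fun i => iter i (fun k => next k.+1) (next 0%N)).
  by apply: homo_ltn_succ => i /=; apply: (nextP _).1.
by case=> [|i] /=; apply: (nextP _).2.
Qed.

Section WellQuasiOrder.
Variables (X : Type) (R : X -> X -> Prop).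
Implicit Types (D : X -> Prop) (f : nat -> X).

Definition wqo D := forall f, (forall i, D (f i)) ->
  exists i j, (i < j)%N /\ R (f i) (f j).

Lemma wqo_or D1 D2 : wqo D1 -> wqo D2 -> wqo (fun x => D1 x \/ D2 x).
Proof.
move=> w1 w2 f fD; have [inf|fin] := classic (forall N, exists2 i, (N <= i)%N & D1 (f i)).
  have [u uI uD] := infinitely_often inf.
  by have [i [j [ij Rij]]] := w1 (f \o u) uD; exists (u i), (u j); split=> //; apply: uI.
have [N finN] : exists N, forall i, (N <= i)%N -> ~ D1 (f i).
  apply: NNPP => no; apply: fin => N; apply: NNPP => noi; apply: no; exists N.
  by move=> i Ni Di; apply: noi; exists i.
have [i|i [j [ij Rij]]] := w2 (fun i => f (N + i)%N).
  by case: (fD (N + i)%N) => // /finN; rewrite leq_addr => /(_ isT).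
by exists (N + i)%N, (N + j)%N; rewrite ltn_add2l.
Qed.

(** Pigeonhole on the first [#|T|.+1] terms. Codes form a relation, since an element may have
    several. *)
Lemma wqo_finite D (T : finType) (code : X -> T -> Prop) :
  (forall x, D x -> exists c, code x c) ->
  (forall x y c, D x -> D y -> code x c -> code y c -> R x y) -> wqo D.
Proof.
move=> codeD codeR f fD.
have /choice_fun[c cP] : forall i, exists c, code (f i) c by move=> i; apply: codeD.
apply: NNPP => bad; have : injective (fun i : 'I_#|T|.+1 => c i).
  move=> i j cij; apply: NNPP => /eqP ij; apply: bad.
  have := cP i; have := cP j; rewrite -cij => cj ci.
  case: (ltngtP i j) => [lt_ij|lt_ji|/val_inj e]; last by rewrite e eqxx in ij.
    by exists i, j; split=> //; apply: (codeR _ _ (c i)).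
  by exists j, i; split=> //; apply: (codeR _ _ (c i)).
by move/leq_card; rewrite card_ord ltnn.
Qed.

Hypothesis R_trans : forall x y z, R x y -> R y z -> R x z.

(** Infinitely many terminal indices, those with no later term above them, would give a bad
    subsequence. Beyond the last one, a later larger term can always be chosen. *)
Lemma wqo_monotone_subseq D f : wqo D -> (forall i, D (f i)) ->
  exists2 s : nat -> nat, {homo s : i j / (i < j)%N}
    & forall i j, (i < j)%N -> R (f (s i)) (f (s j)).
Proof.
move=> wD fD; pose terminal i := ~ exists2 j, (i < j)%N & R (f i) (f j).
have [inf|fin] := classic (forall N, exists2 i, (N <= i)%N & terminal i).
  have [u uI uT] := infinitely_often inf.
  have [i [j [ij Rij]]] := wD (f \o u) (fun i => fD (u i)).
  by case: (uT i); exists (u j) => //; apply: uI.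
have [N finN] : exists N, forall i, (N <= i)%N -> exists2 j, (i < j)%N & R (f i) (f j).
  apply: NNPP => no; apply: fin => N; apply: NNPP => noi; apply: no; exists N.
  by move=> i Ni; apply: NNPP => ti; apply: noi; exists i.
have /choice_fun[next nextP] : forall i, exists j, (N <= i)%N -> (i < j)%N /\ R (f i) (f j).
  move=> i; have [Ni|iN] := leqP N i; last by exists 0%N.
  by have [j] := finN i Ni; exists j.
pose s i := iter i next N.
have Ns i : (N <= s i)%N.
  by elim: i => //= i IH; apply: leq_trans (ltnW (nextP _ IH).1).
exists s; first by apply: homo_ltn_succ => i; apply: (nextP _ (Ns i)).1.
move=> i j; elim: j => // j IH; rewrite ltnS leq_eqVlt => /orP[/eqP->|ij].
  exact: (nextP _ (Ns j)).2.
by apply: R_trans (IH ij) _; apply: (nextP _ (Ns j)).2.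
Qed.

End WellQuasiOrder.

Section Higman.
Variables (X : Type) (R : X -> X -> Prop) (D : X -> Prop).
Hypothesis R_trans : forall x y z, R x y -> R y z -> R x z.

Let bad (f : nat -> seq X) := (forall i, List.Forall D (f i)) /\
  forall i j, (i < j)%N -> ~ lemb R (f i) (f j).

Let extendable (p : seq (seq X)) :=
  exists2 f, bad f & forall i, (i < size p)%N -> f i = nth [::] p i.

Let minimal_extension p : extendable p -> exists y, extendable (rcons p y) /\
  forall z, extendable (rcons p z) -> (size y <= size z)%N.
Proof.
move=> [f badf fp].
have : extendable (rcons p (f (size p))).
  exists f => // i; rewrite size_rcons ltnS leq_eqVlt nth_rcons => /orP[/eqP->|ip].
    by rewrite ltnn eqxx.
  by rewrite ip fp.
move: (f (size p)) => y; have [N] := ubnP (size y); elim: N y => // N IHN y.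
rewrite ltnS => yN ey.
case: (classic (exists2 z, extendable (rcons p z) & (size z < size y)%N)) => [[z ez zy]|min].
  by apply: IHN ez; apply: leq_trans yN.
by exists y; split=> // z ez; rewrite leqNgt; apply/negP => zy; apply: min; exists z.
Qed.

(* Nash-Williams' minimal bad sequence argument. *)
Lemma higman : wqo R D -> wqo (lemb R) (List.Forall D).
Proof.
move=> wD f0 f0D; apply: NNPP => f0bad.
have ext0 : extendable [::].
  by exists f0 => //; split=> // i j ij Rij; apply: f0bad; exists i, j.
have /choice_fun[step stepP] : forall p, exists y, extendable p ->
    extendable (rcons p y) /\
    forall z, extendable (rcons p z) -> (size y <= size z)%N.
  move=> p; have [ep|nep] := classic (extendable p).
    by have [y] := minimal_extension ep; exists y.
  by exists [::].
(* Each word of [g] is as short as possible among those that keep the prefix extendable to a bad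
   sequence. *)
pose pre k := iter k (fun p => rcons p (step p)) [::]; pose g k := step (pre k).
have preE k : pre k = mkseq g k.
  by elim: k => // k IH; rewrite mkseqS -IH.
have extg k : extendable (mkseq g k).
  by rewrite -preE; elim: k => // k IH; case: (stepP (pre k) IH).
have ming k z : extendable (rcons (mkseq g k) z) -> (size (g k) <= size z)%N.
  by rewrite -preE; apply: (stepP _ _).2; rewrite preE.
have badg : bad g.
  split=> [i|i j ij].
    have [f [fD _] fg] := extg i.+1; have := fD i.
    by rewrite fg ?size_mkseq // nth_mkseq.
  have [f [_ fbad] fg] := extg j.+1; have := fbad i j ij.
  by rewrite !fg ?size_mkseq ?nth_mkseq // ltnS ltnW.
have [gD gbad] := badg.
have /choice_fun[xl xlE] : forall i, exists xl : X * seq X, g i = xl.1 :: xl.2.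
  move=> i; case gi : (g i) => [|x l]; last by exists (x, l).
  by case: (gbad i i.+1 (leqnn _)); rewrite gi; apply: lemb_nil.
have xlD i : D (xl i).1 /\ List.Forall D (xl i).2.
  by have := gD i; rewrite xlE => /List.Forall_cons_iff.
have [s sI sR] := wqo_monotone_subseq R_trans wD (fun i => (xlD i).1).
have s0 i : (s 0 <= s i)%N by case: i => // i; apply/ltnW/sI.
(* Before [s 0] this is [g], afterwards the tails along the subsequence with increasing heads. It is
   again bad, but its word at [s 0] is shorter than that of [g], against minimality. *)
pose h i := if (i < s 0)%N then g i else (xl (s (i - s 0)%N)).2.
have badh : bad h.
  split=> [i|i j ij]; rewrite /h; first by case: ifP => _; [apply: gD | apply: (xlD _).2].
  have [j0|j0] := ltnP j (s 0); first by rewrite (ltn_trans ij j0); apply: gbad.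
  have [i0|i0] := ltnP i (s 0) => Rij.
    apply: (gbad i (s (j - s 0))%N); first exact: leq_trans (s0 _).
    by rewrite [g (s _)]xlE; apply: lemb_skip.
  have lt_s : (i - s 0 < j - s 0)%N by rewrite ltn_sub2r // (leq_ltn_trans i0).
  apply: (gbad (s (i - s 0)) (s (j - s 0)))%N; first exact: sI.
  by rewrite !xlE; apply: lemb_cons Rij; apply: sR.
have : extendable (rcons (mkseq g (s 0)) (xl (s 0)).2).
  exists h => // i; rewrite size_rcons size_mkseq ltnS nth_rcons size_mkseq /h.
  rewrite leq_eqVlt => /orP[/eqP->|i0]; first by rewrite ltnn eqxx subnn.
  by rewrite i0 nth_mkseq.
by move/ming; rewrite xlE /= ltnn.
Qed.

End Higman.

(** * Well-quasi-ordering of decomposed matrices *)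

(** Absolute numerator, denominator and sign: a finite type whose decoding reaches every rational of
    size at most [k]. *)
Definition rat_code k : Type := ('I_(2 ^ k) * 'I_(2 ^ k) * bool)%type.

Definition rat_decode k (c : rat_code k) : rat :=
  (-1) ^+ c.2 * (c.1.1%:R / c.1.2%:R).

Lemma rat_codeP k r : (rat_size r <= k)%N -> exists c : rat_code k, rat_decode c = r.
Proof.
rewrite /rat_size /bitlen => rk.
have lt_pow x : (up_log 2 x.+1 <= k)%N -> (x < 2 ^ k)%N.
  move=> xk; apply: leq_trans (up_logP x.+1 (leqnn 2)) _.
  by rewrite leq_exp2l.
have nk := lt_pow _ (leq_trans (leq_addr _ _) rk).
have dk := lt_pow _ (leq_trans (leq_addl _ _) rk).
exists (Ordinal nk, Ordinal dk, (numq r < 0)%R).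
rewrite /rat_decode /= mulrA -[RHS]divq_num_den; congr (_ / _).
  by rewrite [in RHS](intEsign (numq r)) rmorphM rmorph_sign.
by rewrite -(absz_denq r).
Qed.

Lemma mx_codeP k p q (M : 'M[rat]_(p, q)) : (forall i j, rat_size (M i j) <= k)%N ->
  exists C : 'M[rat_code k]_(p, q), map_mx (@rat_decode k) C = M.
Proof.
move=> Mk; have /choice_fun[c cP] : forall ij, exists c : rat_code k, rat_decode c = M ij.1 ij.2.
  by move=> ij; apply: rat_codeP.
by exists (\matrix_(i, j) c (i, j)); apply/matrixP => i j; rewrite !mxE cP.
Qed.

(** The first condition provides the default image in [rep_emb]. Rows added to [oL] are columns of
    [oA], so the bound [k] survives contraction. *)
Definition bounded k t (O : obj t) : Prop :=
  [/\ (0 < on O)%N, forall i j, (rat_size (oA O i j) <= k)%N,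
      forall i j, (rat_size (oL O i j) <= k)%N & row_free (oL O)].

(** [g] picks [t] coordinates on which [oL] is nonsingular; the code stores that square submatrix
    and the same coordinates of the loop. *)
Definition loop_code k t (O : obj t) (c : 'M[rat_code k]_t * 'rV[rat_code k]_t) : Prop :=
  exists j (g : 'I_t -> 'I_(om O)),
  [/\ oS O = [set j], (colv (oA O) j <= oL O)%MS,
      map_mx (@rat_decode k) c.1 = colsub g (oL O), colsub g (oL O) \in unitmx
    & map_mx (@rat_decode k) c.2 = colsub g (colv (oA O) j)].

Lemma loop_codeP k t (O : obj t) : bounded k O -> loop O -> exists c, loop_code (k := k) O c.
Proof.
move=> [_ Ak Lk frL] [j Sj jL].
have full : row_full (oL O)^T by rewrite /row_full mxrank_tr.
pose g := fullrankfun full.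
have [|B BE] := @mx_codeP k _ _ (colsub g (oL O)); first by move=> i l; rewrite mxE.
have [|b bE] := @mx_codeP k _ _ (colsub g (colv (oA O) j)).
  by move=> i l; rewrite !mxE.
exists (B, b), j, g; split=> //.
by rewrite -unitmx_tr trmx_mxsub fullrowsub_unit.
Qed.

(* Cramer's rule: a column in the span of [oL O] is determined by bounded data. *)
Lemma loop_code_emb k t (O1 O2 : obj t) (c : 'M[rat_code k]_t * 'rV[rat_code k]_t) :
  row_free (oL O1) -> row_free (oL O2) -> loop_code O1 c -> loop_code O2 c -> emb O1 O2.
Proof.
move=> fr1 fr2 [j1 [g1 [S1 /submxP[x1 E1] L1 U1 b1]]] [j2 [g2 [S2 /submxP[x2 E2] L2 U2 b2]]].
(* On the chosen coordinates both solve the same nonsingular system. *)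
have x12 : x1 = x2.
  move: b1 b2; rewrite E1 E2 -!mulmx_colsub -L1 -L2 => -> /esym.
  by rewrite -L1 in U1 => /(can_inj (mulmxK U1)).
exists (fun=> j2); rewrite S1 S2; split.
- by move=> i j; rewrite !inE => /eqP-> /eqP->.
- by apply/subsetP => _ /imsetP[i _ ->]; rewrite inE.
move=> a l aj.
have comb q (B : 'M_(_, q)) : a *m B = a 0 j1 *: row j1 B.
  rewrite mulmx_sum_row (bigD1 j1) //= big1 ?addr0 // => i ij.
  by rewrite (suppP _ _ aj) ?scale0r // inE.
rewrite !comb row_rowsub -!tr_col -/(colv _ _) -/(colv _ _) E1 E2 -x12 !scalemxAl -!mulmxDl.
by split=> /eqP; rewrite mulmx_free_eq0 // => /eqP->; rewrite mul0mx.
Qed.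

Lemma emb_forget t m1 n1 (A1 : 'M_(m1, n1)) S1 (L1 : 'M_(t, m1)) u1
    m2 n2 (A2 : 'M_(m2, n2)) S2 (L2 : 'M_(t, m2)) u2 :
  emb (Obj A1 S1 (col_mx L1 u1 : 'M_(t + 1, m1))) (Obj A2 S2 (col_mx L2 u2 : 'M_(t + 1, m2))) ->
  emb (Obj A1 S1 L1) (Obj A2 S2 L2).
Proof.
move=> [f [fI f12 fE]]; exists f; split=> // a l aS.
by have := fE a (row_mx l 0) aS; rewrite /= !mul_row_col !mul0mx !addr0.
Qed.

Lemma rep_Forall t m n (A : 'M_(m, n)) (L : 'M_(t, m)) S l (P : obj t -> Prop) :
  (forall C, P (Obj A C L)) -> rep A L S l -> List.Forall P l.
Proof. by move=> PA; elim=> *; constructor. Qed.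

(** Higman's lemma compares the lists of summands, and [rep_emb] turns their comparison into an
    embedding of the direct sums. *)
Lemma wqo_decomposed_block k h t :
  wqo (@emb t) (fun O => bounded k O /\ block h O) ->
  wqo (@emb t) (fun O => bounded k O /\ decomposed h (oA O) (oL O) (oS O)).
Proof.
move=> w f fD.
have /choice_fun[l lP] : forall i, exists l, rep (oA (f i)) (oL (f i)) (oS (f i)) l /\
    List.Forall (fun O => bounded k O /\ block h O) l.
  move=> i; have [bO [l repl lh]] := fD i; exists l; split=> //.
  by apply/List.Forall_and => //; apply: rep_Forall repl.
have [i [j [ij lij]]] := higman (@emb_trans t) w (fun i => (lP i).2).
exists i, j; split=> //; move: (fD i) (fD j) (lP i) (lP j).
case: (f i) => m1 n1 A1 S1 L1; case: (f j) => m2 n2 A2 S2 L2 /=.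
move=> [[_ _ _ fr1] _] [[n2_gt0 _ _ fr2] _] [rep1 _] [rep2 _].
exact: (rep_emb (Ordinal n2_gt0) fr1 fr2 lij).
Qed.

(** Induction on the height, for all [t] at once. Loops have finitely many codes; inner nodes are
    compared after copying the contracted column into a new row of [oL], which [emb_forget] then
    drops. *)
Lemma wqo_block k h t : wqo (@emb t) (fun O => bounded k O /\ block h O).
Proof.
have wqo_loop t' : wqo (@emb t') (fun O => bounded k O /\ loop O).
  apply: (wqo_finite (code := @loop_code k t')) => [O [bO lO]|O1 O2 c].
    exact: loop_codeP.
  by move=> [[_ _ _ fr1] _] [[_ _ _ fr2] _]; apply: loop_code_emb.
elim: h t => [|h IH] t f fD; first by apply: wqo_loop => i; have [bO [|]] := fD i.
pose contracted (O : obj t) (O' : obj (t + 1)) := exists2 j,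
  O' = Obj (oA O) (oS O) (col_mx (oL O) (colv (oA O) j)) &
  bounded k O' /\ decomposed h (oA O') (oL O') (oS O').
apply: (wqo_or (wqo_loop t) (D2 := fun O => exists O', contracted O O')); last first.
  move=> i; have [bO [lO|[j [jS jL] dO]]] := fD i; [by left | right].
  exists (Obj (oA (f i)) (oS (f i)) (col_mx (oL (f i)) (colv (oA (f i)) j))), j => //.
  split=> //; have [n0 Ak Lk frL] := bO; split=> //=; last exact: row_free_col_mx.
  move=> a b; rewrite mxE; case: splitP => // a' _; by rewrite !mxE.
move=> {fD}f /choice_fun[f' ff'].
have [|i [j [ij Eij]]] := wqo_decomposed_block (IH (t + 1)%N) (f := f').
  by move=> i; case: (ff' i).
exists i, j; split=> //; move: Eij (ff' i) (ff' j).
case: (f i) => m1 n1 A1 S1 L1; case: (f j) => m2 n2 A2 S2 L2 Eij [j1 E1 _] [j2 E2 _].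
by move: Eij; rewrite E1 E2; apply: emb_forget.
Qed.

Lemma wqo_decomposed k h t :
  wqo (@emb t) (fun O => bounded k O /\ decomposed h (oA O) (oL O) (oS O)).
Proof. exact/wqo_decomposed_block/wqo_block. Qed.

(** * Critical matrices *)

Definition critical d k (O : obj 0) : Prop :=
  [/\ entry_complexity (oA O) = k, csd_mat (oA O) d, oS O = [set: 'I_(on O)]
    & forall e, exists2 d', csd_del (oA O) e d' & (d' < d)%N].

Lemma critical_bounded d k (O : obj 0) : (0 < on O)%N -> critical d k O ->
  bounded k O /\ decomposed (2 ^ d).-1 (oA O) (oL O) (oS O).
Proof.
case: O => m n A S L /= n0 [/= Ak [csdA _] SE _].
have frL : row_free L by rewrite /row_free -leqn0 rank_leq_row.
split; last by rewrite SE; apply: csd_le_decomposed csdA => //; apply/eqmxP; rewrite flatmx0 !sub0mx.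
split=> //= [i j|[]//]; move: Ak; rewrite /= /entry_complexity => <-.
by rewrite (leq_trans _ (leq_bigmax i)) // (leq_trans _ (leq_bigmax j)).
Qed.

(** An embedding would miss a column [e] of the larger matrix, making the smaller matroid a
    restriction of a deletion, with csd below [d]. *)
Lemma critical_not_emb d k (O1 O2 : obj 0) : (on O1 < on O2)%N ->
  critical d k O1 -> critical d k O2 -> ~ emb O1 O2.
Proof.
case: O1 O2 => [m1 n1 A1 S1 L1] [m2 n2 A2 S2 L2] /= n12.
move=> [_ /= [_ min] S1E _] [_ _ _ /= del] [f /= [fI _ fE]].
have f_inj : injective f by move=> i j; apply: fI; rewrite S1E inE.
have [e ef] : exists e, e \notin f @: setT.
  apply/existsP; rewrite -negb_forall; apply: contraTN n12 => /forallP all.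
  rewrite -leqNgt -[n2]card_ord -[n1]card_ord -!cardsT -(card_imset setT f_inj).
  by apply/subset_leq_card/subsetP => e _; apply: all.
have [d' [csd2 _] lt_d'd] := del e.
have csd1 : csd_le A1 setT 0 d'.
  apply: csd_le_pullback f_inj _ _ csd2.
    apply/subsetP => _ /imsetP[i _ ->]; rewrite !inE andbT.
    by apply: contraNneq ef => <-; rewrite imset_f.
  move=> a _; rewrite !submx0; apply/eqP/eqP => aA.
    by have := fE a 0; rewrite S1E subsetT !mul0mx !addr0 => /(_ isT) [-> ].
  by have := fE a 0; rewrite S1E subsetT !mul0mx !addr0 => /(_ isT) [_ ->].
by have := min _ csd1; rewrite leqNgt lt_d'd.
Qed.

(** Otherwise there is a sequence of critical objects with strictly increasing numbers of columns,
    in which some term embeds in a later one. The bound comes by contradiction and is not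
    explicit. *)
Lemma critical_size d k : exists N, forall O : obj 0, critical d k O -> (on O <= N)%N.
Proof.
apply: NNPP => unbounded.
have /choice_fun[F FP] : forall N, exists O : obj 0, critical d k O /\ (N < on O)%N.
  move=> N; apply: NNPP => none; apply: unbounded; exists N => O cO.
  by rewrite leqNgt; apply/negP => NO; apply: none; exists O.
pose f i := iter i (fun O => F (on O)) (F 0%N).
have fP i : critical d k (f i) /\ (0 < on (f i))%N.
  case: i => [|i] /=; first exact: FP.
  by have [? lt_n] := FP (on (f i)); split=> //; apply: leq_ltn_trans lt_n.
have f_lt : {homo (fun i => on (f i)) : i j / (i < j)%N}.
  by apply: homo_ltn_succ => i; apply: (FP _).2.
have [|i [j [ij Eij]]] := wqo_decomposed (k := k) (h := (2 ^ d).-1) (f := f).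
  by move=> i; have [cO n0] := fP i; apply: critical_bounded cO.
exact: (critical_not_emb (f_lt i j ij) (fP i).1 (fP j).1).
Qed.

Theorem theorem14 :
  exists f : nat -> nat -> nat,
    forall (d k m n : nat) (A : 'M[rat]_(m, n)),
      entry_complexity A = k ->
      csd_mat A d ->
      (forall e : 'I_n, exists2 d', csd_del A e d' & (d' < d)%N) ->
      (n <= f d k)%N.
Proof.
have /choice_fun[f fP] := fun dk : nat * nat => critical_size dk.1 dk.2.
exists (fun d k => f (d, k)) => d k m n A Ak csdA del.
exact: (fP (d, k) (Obj A [set: 'I_n] (0 : 'M_(0, m)))).
Qed.
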